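(* Let $d\ge1$ be an integer and $f:\bigcup_{n\ge1}\mathfrak{S}_n\to\mathbb{R}^d$, and let $|\cdot|$ be the Euclidean norm on $\mathbb{R}^d$. Suppose that: (i) $\displaystyle\sup_{\sigma\in\bigcup_{n\ge1}\mathfrak{S}_n}\ \sup_{\rho\in A_\sigma}\frac{|f(\sigma)-f(\rho)|}{\#(\sigma)}<+\infty$; (ii) there exist a continuous function $J$, real numbers $0<\beta\le\alpha<1$ and an open set $\mathcal{I}\subset\mathbb{R}^d$ such that for every $x\in\mathcal{I}$, \[\lim_{n\to\infty}\frac{1}{n^\beta}\ln\mathbb{P}\big(f(\sigma_n^{\mathrm{Unif}})\ge x n^\alpha\big)=-J(x);\] (iii) the sequence of random permutations $(\sigma_n)_{n\ge1}$ satisfies $\mathcal{CI}_{\alpha,\beta}$. Then for every $x\in\mathcal{I}$, \[\lim_{n\to\infty}\frac{1}{n^\beta}\ln\mathbb{P}\big(f(\sigma_n)\ge x n^\alpha\big)=-J(x).\]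
   Context: $\mathfrak{S}_n$ is the set of permutations of $\{1,\dots,n\}$; $\#(\sigma)$ is the number of cycles of $\sigma$; $\sigma_n^{\mathrm{Unif}}$ is a uniformly distributed random element of $\mathfrak{S}_n$. For $a,b\in\mathbb{R}^d$, $a\ge b$ means $a_i\ge b_i$ for all $i$. For $\sigma\in\mathfrak{S}_n$: if $\#(\sigma)=1$, $A_\sigma=\{\sigma\}$; if $\#(\sigma)>1$, $A_\sigma$ is the set of $\rho\in\mathfrak{S}_n$ with $\#(\rho)=1$ such that $\rho=\sigma\circ(i_1,i_2)\circ(i_1,i_3)\circ\cdots\circ(i_1,i_{\#(\sigma)})$ for some distinct $i_1,\dots,i_{\#(\sigma)}\in\{1,\dots,n\}$. A random permutation $\sigma_n$ of size $n$ is conjugacy invariant if $\rho\sigma_n\rho^{-1}$ has the same law as $\sigma_n$ for every $\rho\in\mathfrak{S}_n$. For $0<\alpha,\beta\le1$, $(\sigma_n)_{n\ge1}$ satisfies $\mathcal{CI}_{\alpha,\beta}$ if each $\sigma_n$ is a conjugacy invariant random permutation of size $n$ and for every $\varepsilon>0$, $\lim_{n\to\infty}n^{-\beta}\ln\mathbb{P}(\#(\sigma_n)/n^\alpha>\varepsilon)=-\infty$. *)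

(* Defs.v *)
From HB Require Import structures.
From mathcomp Require Import all_boot all_order all_algebra all_fingroup.
From mathcomp Require Import all_classical all_reals all_analysis.

Set Implicit Arguments.
Unset Strict Implicit.
Unset Printing Implicit Defensive.

Import Order.TTheory GRing.Theory Num.Theory.
Import numFieldTopology.Exports.

Local Open Scope classical_set_scope.
Local Open Scope ring_scope.

(* The instances are attached to [perm_type], the type to which {perm T} and
   'S_n unfold. *)
HB.instance Definition _ (T : finType) := isPointed.Build (perm_type T) 1%g.

HB.instance Definition _ (T : finType) :=
  @isMeasurable.Build default_measure_display (perm_type T)
    (@discrete_measurable (perm_type T)) (@discrete_measurable0 (perm_type T))
    (@discrete_measurableC (perm_type T)) (@discrete_measurableU (perm_type T)).

(* Fixed points count as cycles. *)
Definition ncycles (n : nat) (s : 'S_n) : nat := #|porbits s|.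

(* [mul_transp s i1 [:: i2; ...; ik]] is the composite of functions
   s o (i1,i2) o (i1,i3) o ... o (i1,ik).  The product of {perm _} is in
   diagrammatic order, (u * v) x = v (u x), so s o t is written t * s. *)
Definition mul_transp (n : nat) (s : 'S_n) (i1 : 'I_n) (js : seq 'I_n) : 'S_n :=
  foldl (fun r j => (tperm i1 j * r)%g) s js.

Definition Aset (n : nat) (s : 'S_n) : {set 'S_n} :=
  if ncycles s == 1%N then [set s]%SET else
  [set r : 'S_n | (ncycles r == 1%N) &&
    [exists i1 : 'I_n, exists js : (ncycles s).-1.-tuple 'I_n,
      uniq (i1 :: js) && (r == mul_transp s i1 js)]]%SET.

(* The library norm on matrices is the sup norm. *)
Definition enorm (R : realType) (d : nat) (v : 'rV[R]_d) : R :=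
  Num.sqrt (\sum_(i < d) v 0 i ^+ 2).

Definition vge (R : realType) (d : nat) (a b : 'rV[R]_d) : Prop :=
  forall i : 'I_d, b 0 i <= a 0 i.

Definition uniform_rperm (R : realType) (n : nat) (dsp : measure_display)
    (T : measurableType dsp) (P : probability T R) (X : {RV P >-> 'S_n}) : Prop :=
  forall s : 'S_n, distribution P X [set s] = (n`!%:R^-1)%:E.

(* [X w ^ r] is r^-1 * X w * r in diagrammatic order, i.e. r o X w o r^-1. *)
Definition conj_invariant (R : realType) (n : nat) (dsp : measure_display)
    (T : measurableType dsp) (P : probability T R) (X : {RV P >-> 'S_n}) : Prop :=
  forall (r : 'S_n) (B : set 'S_n),
    P [set w | B (X w ^ r)%g] = P [set w | B (X w)].

(* [lne 0 = -oo], so vanishing probabilities are treated correctly. *)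
Definition scaled_lnP (R : realType) (b : R) (dsp : nat -> measure_display)
    (T : forall n, measurableType (dsp n)) (P : forall n, probability (T n) R)
    (E : forall n, set (T n)) (n : nat) : \bar R :=
  (((n%:R `^ b)^-1)%:E * lne (P n (E n)))%E.

Definition CI (R : realType) (a b : R) (dsp : nat -> measure_display)
    (T : forall n, measurableType (dsp n)) (P : forall n, probability (T n) R)
    (X : forall n, {RV (P n) >-> 'S_n}) : Prop :=
  (forall n, (0 < n)%N -> conj_invariant (X n)) /\
  (forall eps : R, 0 < eps ->
    scaled_lnP b P
      (fun n => [set w | (ncycles (X n w))%:R / n%:R `^ a > eps]) @ \oo
    --> -oo%E).

(* Main.v *)
(* Replacing a permutation s by a uniform element of Aset s transports every
   conjugation-invariant law to the uniform law on the n-cycles, and changes f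
   by at most C * ncycles s. Both sigma_n and sigma_n^Unif are thereby compared
   with the same law, so that outside the events {ncycles > eps n^alpha} the
   probabilities P(f >= x n^alpha) for one of them are bounded by those for the
   other after a small shift of x. These events are negligible at scale n^beta:
   by CI for sigma_n, and for sigma_n^Unif because E[c ^ ncycles] <= (n+1)^c for
   every integer c >= 1, by Burnside's lemma. Continuity of J then removes the
   shift. *)

Require Import Defs.
From HB Require Import structures.
From mathcomp Require Import all_boot all_order all_algebra all_fingroup.
From mathcomp Require Import all_classical all_reals all_analysis.
From mathcomp Require Import ring lra.

Set Implicit Arguments.
Unset Strict Implicit.
Unset Printing Implicit Defensive.

Import Order.TTheory GRing.Theory Num.Theory.
Import numFieldTopology.Exports.

(** * Cycles, merging by transpositions, and the sets [Aset] *)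

Section PermutationCombinatorics.
Import boot.fintype boot.finset.

Lemma porbitJ (T : finType) (s g : {perm T}) (x : T) :
  porbit (s ^ g)%g (g x) = g @: porbit s x.
Proof.
apply/setP => y; apply/porbitP/imsetP => [[k ->]|[z /porbitP[k ->] ->]].
  by exists ((s ^+ k)%g x); rewrite ?mem_porbit// -conjXg permJ.
by exists k; rewrite -conjXg permJ.
Qed.

(** The product sends [j] to [s i] and from there follows [s], since the cycle of [i] avoids [j];
    the walk is only altered once it is back at [i], and by then it has covered the whole cycle. *)
Lemma porbit_sub_mul_tperm (T : finType) (s : {perm T}) (i j : T) :
  j \notin porbit s i -> porbit s i \subset porbit (tperm i j * s)%g j.
Proof.
move=> jsi; have tsj : s i \in porbit (tperm i j * s)%g j.
  by apply/porbitP; exists 1%N; rewrite expg1 permM tpermR.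
have step k : (s ^+ k.+1)%g i \in porbit (tperm i j * s)%g j.
  elim: k => [|k IHk]; first by rewrite expg1.
  (* If the walk is back at [i], its next point under [s] is [s i], already reached by [tsj]. *)
  rewrite expgSr permM; have [->//|ki] := eqVneq ((s ^+ k.+1)%g i) i.
  have kj : (s ^+ k.+1)%g i != j by apply: contraNneq jsi => <-; exact: mem_porbit.
  move/porbitP: IHk => [l e]; apply/porbitP; exists l.+1.
  by rewrite [in RHS]expgSr permM -e permM tpermD// eq_sym.
apply/subsetP => y /porbitP[k ->]; case: k => [|k]; last exact: step.
(* The point [i] itself is reached last, as [s] to the power of its order. *)
rewrite expg0 perm1; have := step (#[s]%g).-1.
by rewrite prednK ?order_gt0// expg_order perm1.
Qed.

Lemma porbit_mul_tperm (T : finType) (s : {perm T}) (i j : T) :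
  j \notin porbit s i -> j |: porbit s i \subset porbit (tperm i j * s)%g i.
Proof.
move=> jsi.
have sub_i := porbit_sub_mul_tperm jsi.
have /eqP -> : porbit (tperm i j * s)%g i == porbit (tperm i j * s)%g j.
  by rewrite eq_porbit_mem (subsetP sub_i) ?porbit_id.
by rewrite subUset sub1set porbit_id.
Qed.

Lemma ncyclesJ (n : nat) (s g : 'S_n) : ncycles (s ^ g)%g = ncycles s.
Proof.
rewrite /ncycles -[RHS](card_imset _ (imset_inj (@perm_inj _ g))) /porbits.
congr #|pred_of_set _|.
apply/setP => A; apply/imsetP/imsetP => [[x _ ->]|[_ /imsetP[x _ ->] ->]].
  by exists (porbit s (g^-1 x)%g); rewrite ?imset_f// -porbitJ permKV.
by exists (g x); rewrite ?porbitJ.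
Qed.

Lemma ncycles_gt0 (n : nat) (s : 'S_n) : (0 < n)%N -> (0 < ncycles s)%N.
Proof.
move=> n0; apply/card_gt0P; exists (porbit s (Ordinal n0)); exact: imset_f.
Qed.

Lemma ncycles1_porbit (n : nat) (s : 'S_n) (x y : 'I_n) :
  ncycles s = 1%N -> y \in porbit s x.
Proof.
move=> /eqP/cards1P[A sA]; rewrite -eq_porbit_mem.
have inA z : porbit s z = A by apply/set1P; rewrite -sA imset_f.
by rewrite !inA.
Qed.

Lemma mul_transpJ (n : nat) (s g : 'S_n) (i : 'I_n) (js : seq 'I_n) :
  mul_transp (s ^ g)%g (g i) (map g js) = (mul_transp s i js ^ g)%g.
Proof.
rewrite /mul_transp; elim: js s => //= j js IHjs s.
by rewrite -IHjs conjMg tpermJ.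
Qed.

(** Conjugation by [g] only relabels the points [i1, ..., ik] as [g i1, ..., g ik]. *)
Lemma AsetJ_sub (n : nat) (s r g : 'S_n) :
  r \in Aset s -> (r ^ g)%g \in Aset (s ^ g)%g.
Proof.
rewrite /Aset ncyclesJ; case: ifP => _; first by rewrite !inE => /eqP ->.
rewrite !inE ncyclesJ => /andP[-> /existsP[i /existsP[js /andP[u /eqP ->]]]] /=.
apply/existsP; exists (g i); apply/existsP; exists (map_tuple g js).
apply/andP; split; last by rewrite mul_transpJ.
suff: uniq (map g (i :: js)) by [].
by rewrite map_inj_uniq//; exact: perm_inj.
Qed.

Lemma mem_AsetJ (n : nat) (s r g : 'S_n) :
  ((r ^ g)%g \in Aset (s ^ g)%g) = (r \in Aset s).
Proof.
apply/idP/idP; last exact: AsetJ_sub.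
by move/(@AsetJ_sub _ _ _ g^-1%g); rewrite !conjgK.
Qed.

Lemma AsetJ (n : nat) (s g : 'S_n) : Aset (s ^ g)%g = (Aset s :^ g)%g.
Proof. by apply/setP => r; rewrite mem_conjg -[RHS](mem_AsetJ _ _ g) conjgKV. Qed.

Lemma Aset_ncycles (n : nat) (s r : 'S_n) : r \in Aset s -> ncycles r = 1%N.
Proof.
rewrite /Aset; case: ifP => [/eqP s1|_]; first by rewrite inE => /eqP ->.
by rewrite inE => /andP[/eqP].
Qed.

(* Each transposition merges a new cycle into the cycle of [i]; the [js] avoid
   that growing cycle, hence are distinct. *)
Lemma merge_cycles (n c : nat) (s : 'S_n) (i : 'I_n) : ncycles s = c.+1 ->
  exists js : seq 'I_n, [/\ size js = c, uniq js,
    {in js, forall j, j \notin porbit s i} & ncycles (mul_transp s i js) = 1%N].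
Proof.
elim: c s => [|c IHc] s sc; first by exists [::].
have [j jsi] : exists j, j \notin porbit s i.
  apply/existsP; apply: contra_eqT sc => /existsPn H.
  have -> : ncycles s = 1%N; last by [].
  rewrite /ncycles -(cards1 (porbit s i)); congr #|pred_of_set _|.
  apply/setP => A; rewrite inE; apply/imsetP/eqP => [[x _ ->]|->]; last by exists i.
  by apply/eqP; rewrite eq_porbit_mem; have := H x; rewrite negbK.
have ij : i != j by apply: contraNneq jsi => ->; exact: porbit_id.
pose s' := (tperm i j * s)%g.
have s'c : ncycles s' = c.+1.
  have := porbits_mul_tperm s i j; rewrite /= -/s' porbit_sym jsi ij.
  by rewrite -!/(ncycles _) sc addn1 addn2 => -[].
have [js [sz u d one]] := IHc _ s'c.
have sub := subsetP (porbit_mul_tperm jsi).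
exists (j :: js); split => //=.
- by rewrite sz.
- rewrite u andbT; apply/negP => /d; apply/negP; rewrite negbK.
  by apply: sub; rewrite setU11.
- move=> k; rewrite inE => /predU1P[->//|/d]; apply: contra => ksi.
  by apply: sub; rewrite setU1r.
Qed.

(** Guarantees that a uniform element of [Aset s] exists. The points given by [merge_cycles] lie off
    the cycle of [i], so [i] differs from all of them. *)
Lemma Aset_neq0 (n : nat) (s : 'S_n) : (0 < n)%N -> Aset s != set0.
Proof.
move=> n0; rewrite /Aset; case: ifP => [_|s1].
  by apply/set0Pn; exists s; rewrite inE.
have c0 := ncycles_gt0 s n0.
have [js [sz u d one]] := merge_cycles (Ordinal n0) (esym (prednK c0)).
have sz' : size js == (ncycles s).-1 by rewrite sz.
apply/set0Pn; exists (mul_transp s (Ordinal n0) js); rewrite inE one eqxx /=.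
apply/existsP; exists (Ordinal n0); apply/existsP; exists (Tuple sz') => /=.
by rewrite u eqxx !andbT; apply/negP => /d; rewrite porbit_id.
Qed.

(** The conjugator matches the two cycles point by point from a common origin: it sends [r1^k i0] to
    [r2^k i0]. *)
Lemma long_cycles_conj (n : nat) (r1 r2 : 'S_n) : (0 < n)%N ->
  ncycles r1 = 1%N -> ncycles r2 = 1%N -> exists g : 'S_n, r2 = (r1 ^ g)%g.
Proof.
move=> n0 c1 c2; pose i0 := Ordinal n0.
have full (r : 'S_n) : ncycles r = 1%N -> #|porbit r i0| = n.
  move=> cr; rewrite -[RHS]card_ord -cardsT; apply: eq_card => x.
  by rewrite ncycles1_porbit// inE.
have ut (r : 'S_n) : ncycles r = 1%N -> uniq (traject r i0 n).
  by move=> cr; have := uniq_traject_porbit r i0; rewrite full.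
have mt (r : 'S_n) x : ncycles r = 1%N -> x \in traject r i0 n.
  by move=> cr; have := porbit_traject r i0 x; rewrite full// ncycles1_porbit.
have it (r : 'S_n) : ncycles r = 1%N -> iter n r i0 = i0.
  by move=> cr; have := iter_porbit r i0; rewrite full.
(* The index of [x] in the trajectory is the exponent [k] with [x = r1^k i0]. *)
pose h x := iter (index x (traject r1 i0 n)) r2 i0.
have hE k : (k < n)%N -> h (iter k r1 i0) = iter k r2 i0.
  by move=> kn; rewrite /h -(nth_traject r1 kn) index_uniq ?size_traject ?ut.
have h_inj : injective h.
  move=> x y; rewrite /h.
  set k := index x _; set l := index y _ => e.
  have kn : (k < n)%N by rewrite -(size_traject r1 i0 n) index_mem mt.
  have ln : (l < n)%N by rewrite -(size_traject r1 i0 n) index_mem mt.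
  rewrite -(nth_traject r2 kn) -(nth_traject r2 ln) in e.
  move/eqP: e; rewrite nth_uniq ?size_traject ?ut// => /eqP e.
  by rewrite -(nth_index i0 (mt r1 x c1)) -/k e nth_index ?mt.
exists (perm h_inj); apply/permP => z.
rewrite -{2}(permKV (perm h_inj) z) permJ.
have [x <-] : exists x, perm h_inj x = z by exists ((perm h_inj)^-1 z)%g; rewrite permKV.
rewrite permK !permE; have /trajectP[k kn ->] := mt r1 x c1.
(* The exponent [k.+1] may equal [n], where both trajectories have returned to [i0]. *)
rewrite (hE k kn) -!iterS; have := kn; rewrite leq_eqVlt => /predU1P[e|kn'].
  by rewrite e !it// (hE 0%N).
by rewrite hE.
Qed.

(** * Colorings of the points, for Burnside's lemma *)

Section ColoringAction.
Variables n m : nat.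

(** The inverse makes this a right action for the diagrammatic product. *)
Definition permute_coloring (c : {ffun 'I_n -> 'I_m}) (a : 'S_n) :=
  [ffun i => c ((a^-1)%g i)].

Lemma permute_coloring1 : permute_coloring^~ 1%g =1 id.
Proof. by move=> c; apply/ffunP => i; rewrite ffunE invg1 perm1. Qed.

Lemma permute_coloringM :
  forall c, act_morph permute_coloring c.
Proof. by move=> c a b; apply/ffunP => i; rewrite !ffunE invMg permM. Qed.

Definition coloring_action := TotalAction permute_coloring1 permute_coloringM.

(** A coloring of the set of cycles pulls back to a coloring of the points that [s] fixes, and the
    pullback is injective. *)
Lemma leq_exp_ncycles_fix (s : 'S_n) :
  (m ^ ncycles s <= #|'Fix_coloring_action[s]%g|)%N.
Proof.
pose S := {A : {set 'I_n} | A \in porbits s}.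
have -> : (m ^ ncycles s = #|{ffun S -> 'I_m}|)%N.
  by rewrite card_ffun card_ord card_sig.
pose cyc i : S := exist _ (porbit s i) (imset_f (porbit s) isT).
pose F (c : {ffun S -> 'I_m}) := [ffun i => c (cyc i)].
have F_inj : injective F.
  move=> c1 c2 /ffunP e; apply/ffunP => -[A HA].
  have [i _ eA] := imsetP HA.
  have -> : exist _ A HA = cyc i by apply: val_inj.
  by have := e i; rewrite !ffunE.
rewrite -(card_imset predT F_inj) subset_leq_card//.
apply/subsetP => _ /imsetP[c _ ->]; apply/afix1P; apply/ffunP => i.
rewrite /= !ffunE; congr (c _); apply: val_inj => /=.
apply/eqP; rewrite eq_porbit_mem -porbitV; apply/porbitP.
by exists 1%N; rewrite expg1.
Qed.

(** An orbit is determined by how many points have each of the [m] colors, and each such count takes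
    at most [n.+1] values. *)
Lemma card_coloring_orbits :
  (#|orbit coloring_action [set: 'S_n] @: [set: {ffun 'I_n -> 'I_m}]| <= n.+1 ^ m)%N.
Proof.
pose tup (c : {ffun 'I_n -> 'I_m}) := [tuple c i | i < n].
pose cnt c : {ffun 'I_m -> 'I_n.+1} := [ffun j => inord (count_mem j (tup c))].
pose O := orbit coloring_action [set: 'S_n].
have orb c1 c2 : cnt c1 = cnt c2 -> O c1 = O c2.
  move=> /ffunP e; apply/orbit_eqP/orbitP.
  have /tuple_permP[p /val_inj e12] : perm_eq (tup c1) (tup c2).
    apply/allP => j _; have := congr1 val (e j); rewrite !ffunE.
    have bnd c : (count_mem j (tup c) < n.+1)%N.
      by rewrite ltnS -[X in (_ <= X)%N](size_tuple (tup c)) count_size.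
    by rewrite [LHS]inordK// [RHS]inordK// => /eqP.
  exists p^-1%g; rewrite ?inE//; apply/ffunP => i; rewrite !ffunE invgK.
  by have := congr1 (fun t => tnth t i) e12; rewrite !tnth_mktuple.
(* [G] recovers an orbit from its vector of counts; [set0] is a default for vectors that no coloring
   realizes. *)
pose G v := if [pick c | cnt c == v] is Some c then O c else finset.set0.
have -> : O @: [set: {ffun 'I_n -> 'I_m}] = G @: (cnt @: [set: {ffun 'I_n -> 'I_m}]).
  rewrite -imset_comp; apply: eq_imset => c; rewrite /= /G.
  by case: pickP => [c' /eqP/orb //|/(_ c)]; rewrite eqxx.
rewrite (leq_trans (leq_imset_card _ _))//.
by rewrite (leq_trans (max_card _))// card_ffun !card_ord.
Qed.

End ColoringAction.

(* The number of colorings with [m] colors that are constant on the cycles of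
   [s] is [m ^ ncycles s]; the sum is evaluated by Burnside's lemma. *)
Lemma sum_exp_ncycles (n m : nat) :
  (\sum_(s : 'S_n) m ^ ncycles s <= n.+1 ^ m * n`!)%N.
Proof.
have acts : [acts [set: 'S_n], on [set: {ffun 'I_n -> 'I_m}] | coloring_action n m]%g.
  by apply/actsP => a _ c; rewrite !inE.
have := Frobenius_Cauchy acts; rewrite cardsT card_Sn => FC.
rewrite (leq_trans _ (leq_mul (card_coloring_orbits n m) (leqnn _)))// -FC.
rewrite [leqRHS](eq_bigl xpredT); last by move=> s; rewrite inE.
by apply: leq_sum => s _; rewrite setTI leq_exp_ncycles_fix.
Qed.

End PermutationCombinatorics.

(** * Comparison of conjugation-invariant laws through the long cycles *)

Section ConjugationInvariantWeights.
Import boot.fintype boot.finset.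
Local Open Scope ring_scope.
Variables (R : realFieldType) (n : nat).
Hypothesis n_gt0 : (0 < n)%N.

Definition long_cycles : {set 'S_n} := [set r : 'S_n | ncycles r == 1%N].

Definition conj_invariant_pmf (m : 'S_n -> R) :=
  [/\ forall s, 0 <= m s, \sum_s m s = 1 & forall s g, m (s ^ g)%g = m s].

(* Moving the mass of each [s] uniformly onto [Aset s] gives a
   conjugation-invariant law on the long cycles, which form one conjugacy class:
   it is the uniform law, whatever [m] is. *)
Lemma le_long_cycles (m : 'S_n -> R) (E F : {set 'S_n}) :
  conj_invariant_pmf m -> {in E, forall s, Aset s \subset F} ->
  \sum_(s in E) m s <= #|F :&: long_cycles|%:R / #|long_cycles|%:R.
Proof.
move=> [m0 m1 mJ] EF.
(* [w] is the mass function of the transported law. *)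
pose w r := \sum_s m s * ((r \in Aset s)%:R / #|Aset s|%:R).
have wJ r g : w (r ^ g)%g = w r.
  rewrite /w (reindex_inj (conjg_inj g)); apply: eq_bigr => s _.
  by rewrite mJ mem_AsetJ AsetJ cardJg.
have sum_w (B : {set 'S_n}) :
    \sum_(r in B) w r = \sum_s m s * (#|B :&: Aset s|%:R / #|Aset s|%:R).
  rewrite /w exchange_big /=; apply: eq_bigr => s _.
  rewrite -mulr_sumr -mulr_suml; congr (_ * (_ / _)).
  rewrite -natr_sum -sum1_card; congr (_%:R).
  rewrite [RHS](eq_bigl (fun r => (r \in B) && (r \in Aset s))); last first.
    by move=> r; rewrite inE.
  by rewrite big_mkcondr /=; apply: eq_bigr => r _; case: (r \in _).
have Apos (s : 'S_n) : (0 < #|Aset s|)%N by rewrite card_gt0; exact: Aset_neq0.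
have subK (s : 'S_n) : Aset s \subset long_cycles.
  by apply/fintype.subsetP => r /Aset_ncycles r1; rewrite inE r1.
have tot : \sum_(r in long_cycles) w r = 1.
  rewrite sum_w -[RHS]m1; apply: eq_bigr => s _.
  by rewrite (setIidPr (subK s)) divff ?mulr1// pnatr_eq0 -lt0n.
have [r0 r0A] := set0Pn _ (Aset_neq0 1%g n_gt0).
have r0K := fintype.subsetP (subK 1%g) _ r0A.
have wK r : r \in long_cycles -> w r = w r0.
  move: r0K; rewrite !inE => /eqP c0 /eqP c.
  by have [g ->] := long_cycles_conj n_gt0 c0 c; rewrite wJ.
have Kw : w r0 = (#|long_cycles|%:R)^-1.
  have e : w r0 * #|long_cycles|%:R = 1.
    by rewrite mulr_natr -sumr_const -(eq_bigr _ wK).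
  have K0 : #|long_cycles|%:R != 0 :> R.
    by apply/eqP => K0; move/eqP: e; rewrite K0 mulr0 eq_sym oner_eq0.
  by apply: (mulIf K0); rewrite e mulVf.
have -> : #|F :&: long_cycles|%:R / #|long_cycles|%:R =
    \sum_(r in F :&: long_cycles) w r.
  rewrite (eq_bigr (fun=> w r0)); last by move=> r /setIP[_]; exact: wK.
  by rewrite sumr_const Kw -[RHS]mulr_natl.
(* Each [s] in [E] sends its whole mass into [F]; the other permutations contribute a nonnegative
   amount. *)
rewrite sum_w [leRHS](bigID (mem E))/= -[leLHS]addr0; apply: lerD.
  apply: ler_sum => s sE; rewrite (setIidPr _).
    by rewrite divff ?mulr1// pnatr_eq0 -lt0n.
  by rewrite subsetI EF//= subK.
by apply: sumr_ge0 => s _; rewrite mulr_ge0// divr_ge0.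
Qed.

(** Let [u] be the uniform law on long cycles and [F] the union of the [Aset s] for [s] in [E1].
    Transport gives [m1(E1) <= u(F)]. The sets [Aset s] for [s] outside [E2] miss [F], so also
    [m2(~: E2) <= u(~: F)]; taking complements gives [u(F) <= m2(E2)]. *)
Lemma compare_pmf (m1 m2 : 'S_n -> R) (E1 E2 : {set 'S_n}) :
  conj_invariant_pmf m1 -> conj_invariant_pmf m2 ->
  (forall s1 s2, s1 \in E1 -> s2 \notin E2 -> [disjoint Aset s1 & Aset s2]) ->
  \sum_(s in E1) m1 s <= \sum_(s in E2) m2 s.
Proof.
move=> h1 h2 dis; pose F := \bigcup_(s in E1) Aset s.
have le1 : \sum_(s in E1) m1 s <= #|F :&: long_cycles|%:R / #|long_cycles|%:R.
  by apply: le_long_cycles => // s sE; exact: bigcup_sup.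
have le2 : \sum_(s in ~: E2) m2 s <= #|~: F :&: long_cycles|%:R / #|long_cycles|%:R.
  apply: le_long_cycles => // s; rewrite inE => sE.
  rewrite -disjoints_subset; apply/bigcup_disjointP => s1 s1E.
  by rewrite disjoint_sym; exact: dis.
have K0 : (0 < #|long_cycles|)%N.
  have [r rA] := set0Pn _ (Aset_neq0 1%g n_gt0).
  by apply/card_gt0P; exists r; rewrite inE (Aset_ncycles rA).
have tot : \sum_(s in E2) m2 s + \sum_(s in ~: E2) m2 s = 1.
  have [_ <- _] := h2; rewrite [RHS](bigID (mem E2))/=; congr (_ + _).
  by apply: eq_bigl => s; rewrite inE.
have totF : #|F :&: long_cycles|%:R / #|long_cycles|%:R +
    #|~: F :&: long_cycles|%:R / #|long_cycles|%:R = 1 :> R.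
  rewrite -mulrDl -natrD (setIC F) (setIC (~: F)) -setDE cardsID divff//.
  by rewrite pnatr_eq0 -lt0n.
lra.
Qed.

(** Markov's inequality for [c ^ ncycles] under the uniform law. *)
Lemma uniform_ncycles_tail (c : nat) (x : R) (E : {set 'S_n}) :
  (0 < c)%N -> {in E, forall s, x <= c%:R ^+ ncycles s} ->
  x * \sum_(s in E) (n`!%:R)^-1 <= n.+1%:R ^+ c.
Proof.
move=> c0 xE; rewrite mulr_sumr.
have f0 : (0 : R) < n`!%:R by rewrite ltr0n fact_gt0.
apply: (@le_trans _ _ (\sum_(s : 'S_n) c%:R ^+ ncycles s / n`!%:R)).
  rewrite [leRHS](bigID (mem E))/= -[leLHS]addr0; apply: lerD.
    by apply: ler_sum => s /xE ?; rewrite ler_pM2r// invr_gt0.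
  by apply: sumr_ge0 => s _; rewrite divr_ge0// exprn_ge0.
rewrite -mulr_suml ler_pdivrMr//.
under eq_bigr do rewrite -natrX.
by rewrite -natr_sum -natrX -natrM ler_nat sum_exp_ncycles.
Qed.

End ConjugationInvariantWeights.

Local Open Scope classical_set_scope.
Local Open Scope ring_scope.

(** * From random permutations to their mass functions *)

Section RandomPermutation.
Variables (R : realType) (n : nat) (dsp : measure_display) (T : measurableType dsp).
Variables (P : probability T R) (X : {RV P >-> 'S_n}).

Definition perm_pmf (s : 'S_n) : R := fine (P (X @^-1` [set s])).

Lemma measurable_perm_event (B : set 'S_n) : measurable (X @^-1` B).
Proof. exact: measurable_funPTI. Qed.

Lemma fineK_perm_event (B : set 'S_n) :
  P (X @^-1` B) = (fine (P (X @^-1` B)))%:E.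
Proof. by rewrite fineK// fin_num_measure//; exact: measurable_perm_event. Qed.

Lemma prob_perm_event (E : {set 'S_n}) :
  fine (P (X @^-1` [set` E])) = \sum_(s in E) perm_pmf s.
Proof.
suff seqE (l : seq 'S_n) : uniq l ->
    fine (P (X @^-1` [set` l])) = \sum_(s <- l) perm_pmf s.
  have -> : [set` E] = [set` enum E].
    by apply/seteqP; split => s /=; rewrite mem_enum.
  by rewrite seqE ?enum_uniq// big_enum.
elim: l => [_|s l IHl /= /andP[sl ul]].
  rewrite big_nil (_ : X @^-1` _ = set0) ?measure0//.
  by apply/seteqP; split.
rewrite big_cons -IHl// /perm_pmf.
have -> : X @^-1` [set` s :: l] = X @^-1` [set s] `|` X @^-1` [set` l].
  apply/seteqP; split => w /=; rewrite inE.
    by move=> /predU1P[]; [left|right].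
  by move=> h; apply/predU1P; case: h; [left|right].
rewrite measureU ?fineD ?fin_num_measure//; try exact: measurable_perm_event.
apply/seteqP; split => // w [/= ->]; exact/negP.
Qed.

Lemma conj_invariant_perm_pmf :
  (forall s g, perm_pmf (s ^ g)%g = perm_pmf s) -> conj_invariant_pmf perm_pmf.
Proof.
move=> cX; split => //; first by move=> s; rewrite fine_ge0.
have := prob_perm_event [set: 'S_n]%SET.
rewrite (_ : X @^-1` _ = setT) ?probability_setT/=; last first.
  by apply/seteqP; split => // w _ /=; rewrite inE.
by move=> ->; apply: eq_bigl => s; rewrite inE.
Qed.

Lemma conj_invariantP : conj_invariant X -> conj_invariant_pmf perm_pmf.
Proof.
move=> cX; apply: conj_invariant_perm_pmf => s g.
rewrite /perm_pmf -(cX g [set (s ^ g)%g])/=; congr (fine (P _)).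
by apply/seteqP; split => w /= [] => [/conjg_inj|->].
Qed.

Lemma uniform_pmfE (s : 'S_n) : uniform_rperm X -> perm_pmf s = n`!%:R^-1.
Proof. by move=> uX; rewrite /perm_pmf -[P _]/(distribution P X [set s]) uX. Qed.

Lemma conj_invariant_uniform : uniform_rperm X -> conj_invariant_pmf perm_pmf.
Proof.
by move=> uX; apply: conj_invariant_perm_pmf => s g; rewrite !uniform_pmfE.
Qed.

End RandomPermutation.

(** * Comparison of the events [f >= y] for two random permutations *)

Lemma coord_le_enorm (R : realType) (d : nat) (v : 'rV[R]_d) (i : 'I_d) :
  `|v 0 i| <= enorm v.
Proof.
rewrite -sqrtr_sqr ler_sqrt; last by apply: sumr_ge0 => j _; rewrite sqr_ge0.
by rewrite (bigD1 i)//= lerDl sumr_ge0// => j _; rewrite sqr_ge0.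
Qed.

Section Compare.
Variables (R : realType) (n d : nat) (f : 'S_n -> 'rV[R]_d) (C : R).
Hypotheses (n_gt0 : (0 < n)%N) (C_ge0 : 0 <= C).
Hypothesis fC : forall s r, r \in Aset s -> enorm (f s - f r) <= C * (ncycles s)%:R.
Variables (dsp1 dsp2 : measure_display).
Variables (T1 : measurableType dsp1) (T2 : measurableType dsp2).
Variables (P1 : probability T1 R) (P2 : probability T2 R).
Variables (X1 : {RV P1 >-> 'S_n}) (X2 : {RV P2 >-> 'S_n}).
Hypotheses (cX1 : conj_invariant_pmf (perm_pmf X1)).
Hypotheses (cX2 : conj_invariant_pmf (perm_pmf X2)).

(** If [s1] and [s2] have at most [k] cycles and a common element [r] in their [Aset], then each of
    [f s1] and [f s2] is within [C * k] of [f r]. Hence the shift [2 * C * k] suffices to pass from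
    [y] to [z]. *)
Lemma compare_vge (y z : 'rV[R]_d) (k : R) :
  (forall i, z 0 i + 2 * C * k <= y 0 i) ->
  fine (P1 [set w | vge (f (X1 w)) y]) <=
  fine (P2 [set w | vge (f (X2 w)) z]) + fine (P1 [set w | k < (ncycles (X1 w))%:R])
  + fine (P2 [set w | k < (ncycles (X2 w))%:R]).
Proof.
move=> zy.
pose B1 := [set s : 'S_n | k < (ncycles s)%:R].
pose V u := [set s : 'S_n | vge (f s) u].
(* Permutations with more than [k] cycles are removed from [E1] and added to [E2], so that [s1] in
   [E1] and [s2] outside [E2] both have at most [k] cycles. *)
pose E1 := [set s : 'S_n | `[< vge (f s) y >] && ((ncycles s)%:R <= k)]%SET.
pose E2 := [set s : 'S_n | `[< vge (f s) z >] || (k < (ncycles s)%:R)]%SET.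
have fineU2 dsp (T : measurableType dsp) (P : probability T R)
    (X : {RV P >-> 'S_n}) (A B D : set 'S_n) : D `<=` A `|` B ->
    fine (P (X @^-1` D)) <= fine (P (X @^-1` A)) + fine (P (X @^-1` B)).
  move=> sub; rewrite -lee_fin EFinD -!fineK_perm_event.
  apply: le_trans (measureU2 _ _ _); [|exact: measurable_perm_event..].
  apply: le_measure; rewrite ?inE; [exact: measurable_perm_event| |].
    by apply: measurableU; exact: measurable_perm_event.
  by move=> w /sub.
have le12 : fine (P1 (X1 @^-1` [set` E1])) <= fine (P2 (X2 @^-1` [set` E2])).
  rewrite !prob_perm_event; apply: compare_pmf => // s1 s2.
  rewrite !inE negb_or => /andP[/asboolP V1 k1] /andP[/asboolPn V2].
  rewrite -leNgt => k2; apply/pred0P => r /=; apply/negP => /andP[r1 r2].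
  apply: V2 => i; have Vi := V1 i; have zi := zy i.
  have d1 := le_trans (coord_le_enorm (f s1 - f r) i) (fC r1).
  have d2 := le_trans (coord_le_enorm (f s2 - f r) i) (fC r2).
  have c1 := ler_wpM2l C_ge0 k1; have c2 := ler_wpM2l C_ge0 k2.
  move: d1 d2; rewrite !mxE !ler_norml => /andP[_ d1] /andP[d2 _]; lra.
have u1 : fine (P1 (X1 @^-1` V y)) <=
    fine (P1 (X1 @^-1` [set` E1])) + fine (P1 (X1 @^-1` B1)).
  apply: fineU2 => s /= Vs; rewrite inE; case: (leP (ncycles s)%:R k) => ks; last by right.
  by left; rewrite andbT; apply/asboolP.
have u2 : fine (P2 (X2 @^-1` [set` E2])) <=
    fine (P2 (X2 @^-1` V z)) + fine (P2 (X2 @^-1` B1)).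
  apply: fineU2 => s /=; rewrite inE => /orP[/asboolP|]; by [left|right].
move: le12 u1 u2; rewrite /V /B1 /preimage /=; lra.
Qed.

End Compare.

Lemma uniform_tail (R : realType) (n : nat) (dsp : measure_display)
    (T : measurableType dsp) (P : probability T R) (X : {RV P >-> 'S_n})
    (c : nat) (k : R) : uniform_rperm X -> (0 < c)%N ->
  fine (P [set w | k < (ncycles (X w))%:R]) <=
    expR (c%:R * ln n.+1%:R - k * ln c%:R).
Proof.
move=> uX c0; pose E := [set s : 'S_n | k < (ncycles s)%:R]%SET.
have c0' : (0 : R) < c%:R by rewrite ltr0n.
have -> : [set w | k < (ncycles (X w))%:R] = X @^-1` [set` E].
  by apply/seteqP; split => w /=; rewrite inE.
rewrite prob_perm_event (eq_bigr (fun=> n`!%:R^-1)); last first.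
  by move=> s _; rewrite uniform_pmfE.
rewrite expRD expRN ler_pdivlMr ?expR_gt0// mulrC.
rewrite mulrC expRM_natl lnK ?posrE ?ltr0n// mulrC.
(* The Markov threshold is [c] to the real power [k], written as an exponential. *)
apply: uniform_ncycles_tail => // s; rewrite inE => /ltW ks.
have -> : expR (k * ln c%:R) = c%:R `^ k :> R by rewrite /powR gt_eqF.
by rewrite -powR_mulrn ?ler0n// ler_powR// ler1n.
Qed.

(** * Growth of logarithms and powers of [n] *)

Section Growth.
Variables (R : realType) (b : R).
Hypothesis b_gt0 : 0 < b.

Lemma near_ln_ge (K : R) : \forall n \near \oo, K <= ln (n%:R : R).
Proof.
near=> n; rewrite -[K]expRK ler_ln ?posrE ?expR_gt0//.
  by near: n; exact: nbhs_infty_ger.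
by rewrite (lt_le_trans (expR_gt0 K))//; near: n; exact: nbhs_infty_ger.
Unshelve. all: by end_near. Qed.

Lemma near_powR_ge (K : R) : \forall n \near \oo, K <= n%:R `^ b.
Proof.
near=> n; have n0 : (0 < n)%N by near: n; exact: nbhs_infty_gt.
rewrite /powR pnatr_eq0 gtn_eqF//= (le_trans _ (expR_ge1Dx _))//.
have : K / b <= ln n%:R by near: n; exact: near_ln_ge.
by rewrite ler_pdivrMr// => h; lra.
Unshelve. all: by end_near. Qed.

(** With [t = ln n], the left side is at most linear in [t], while [n^b = expR (b * t / 2) ^+ 2] is
    at least [(b * t / 2) ^+ 2]. *)
Lemma near_ln_le_powR (c : R) :
  \forall n \near \oo, c * ln n.+1%:R <= (n%:R : R) `^ b.
Proof.
near=> n; have n0 : (0 < n)%N by near: n; exact: nbhs_infty_gt.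
pose c' := Num.max c 1.
have c'c : c <= c' by rewrite le_max lexx.
have c'1 : 1 <= c' by rewrite le_max lexx orbT.
have t1 : 1 <= ln (n%:R : R) by near: n; exact: near_ln_ge.
(* This threshold yields [c' * (1 + t) <= 2 * c' * t <= (b * t / 2) ^+ 2]. *)
have tb : 8 * c' / b ^+ 2 <= ln n%:R by near: n; exact: near_ln_ge.
set t := ln (n%:R : R) in t1 tb *.
have lnS : ln n.+1%:R <= 1 + t.
  rewrite -[X in X + _]expRK -lnM ?posrE ?expR_gt0 ?ltr0n// ler_ln ?posrE ?ltr0n//.
    have : 1 + 1 <= expR 1 :> R := expR_ge1Dx 1.
    have : (1 : R) <= n%:R by rewrite ler1n.
    rewrite -natr1; nra.
  by rewrite mulr_gt0 ?expR_gt0// ltr0n.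
have lnS0 : 0 <= ln (n.+1%:R : R) by rewrite ln_ge0// ler1n.
rewrite /powR pnatr_eq0 gtn_eqF//= -/t.
have -> : expR (b * t) = expR (b * t / 2) ^+ 2.
  by rewrite -expRM_natl; congr expR; field.
have e : 1 + b * t / 2 <= expR (b * t / 2) := expR_ge1Dx _.
have bt : 0 < b * t by rewrite mulr_gt0// (lt_le_trans _ t1).
rewrite ler_pdivrMr ?exprn_gt0// in tb.
have h1 : c * ln n.+1%:R <= c' * (1 + t).
  by rewrite (le_trans (ler_wpM2r lnS0 c'c))// ler_wpM2l//; lra.
have h2 : (b * t / 2) ^+ 2 <= expR (b * t / 2) ^+ 2 by rewrite ler_sqr ?nnegrE; lra.
apply: (le_trans h1); apply: (le_trans _ h2).
have : 8 * c' * t <= (t * b ^+ 2) * t by rewrite ler_pM2r//; lra.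
have : c' * 1 <= c' * t by rewrite ler_pM2l//; lra.
rewrite !expr2; nra.
Unshelve. all: by end_near. Qed.

End Growth.

(** * Scaled logarithmic limits as exponential bounds *)

Section ScaledLog.
Variables (R : realType) (b : R) (dsp : nat -> measure_display).
Variables (T : forall n, measurableType (dsp n)) (P : forall n, probability (T n) R).
Variable (E : forall n, set (T n)).
Arguments E : clear implicits.
Hypothesis mE : forall n, measurable (E n).

Let powR_nat_gt0 (n : nat) : (0 < n)%N -> 0 < n%:R `^ b.
Proof. by move=> n0; rewrite powR_gt0// ltr0n. Qed.

Let fineKE (n : nat) : P n (E n) = (fine (P n (E n)))%:E.
Proof. by rewrite fineK// fin_num_measure. Qed.

(** Exponentiating is valid at probability zero too, as [expeR (lne x) = x] for all [x >= 0]. *)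
Lemma scaled_lnP_le (n : nat) (c : R) : (0 < n)%N ->
  (scaled_lnP b P E n <= c%:E)%E = (fine (P n (E n)) <= expR (c * n%:R `^ b)).
Proof.
move=> n0; rewrite /scaled_lnP lee_pdivrMl ?powR_nat_gt0// -EFinM.
rewrite -lee_expeR (eqP (_ : expeR (lne (P n (E n))) == P n (E n))) ?lneK_eq//.
by rewrite [X in (X <= _)%E]fineKE lee_fin mulrC.
Qed.

Lemma scaled_lnP_ge (n : nat) (c : R) : (0 < n)%N ->
  (c%:E <= scaled_lnP b P E n)%E = (expR (c * n%:R `^ b) <= fine (P n (E n))).
Proof.
move=> n0; rewrite /scaled_lnP lee_pdivlMl ?powR_nat_gt0// -EFinM.
rewrite -lee_expeR (eqP (_ : expeR (lne (P n (E n))) == P n (E n))) ?lneK_eq//.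
by rewrite [X in (_ <= X)%E]fineKE lee_fin mulrC.
Qed.

Lemma scaled_lnP_cvg (l : R) :
  scaled_lnP b P E @ \oo --> l%:E <->
  forall e : R, 0 < e -> \forall n \near \oo,
    expR ((l - e) * n%:R `^ b) <= fine (P n (E n)) <= expR ((l + e) * n%:R `^ b).
Proof.
split=> [cvl e e0|h].
  have lo : ((l - e)%:E < l%:E)%E by rewrite lte_fin; lra.
  have hi : (l%:E < (l + e)%:E)%E by rewrite lte_fin; lra.
  have nlo := cvl _ (open_ereal_gt' lo); have nhi := cvl _ (open_ereal_lt' hi).
  near=> n; have n0 : (0 < n)%N by near: n; exact: nbhs_infty_gt.
  rewrite -scaled_lnP_ge// -scaled_lnP_le//.
  by apply/andP; split; apply: ltW; near: n.
have nearb e : 0 < e -> \forall n \near \oo,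
    ((l - e)%:E <= scaled_lnP b P E n <= (l + e)%:E)%E.
  move=> e0; near=> n; have n0 : (0 < n)%N by near: n; exact: nbhs_infty_gt.
  by rewrite scaled_lnP_ge// scaled_lnP_le//; near: n; exact: h.
(* The bounds with [e = 1] exclude infinite values for large [n]. *)
apply/fine_cvgP; split.
  near=> n; have /andP[lo hi] : ((l - 1)%:E <= scaled_lnP b P E n <= (l + 1)%:E)%E.
    by near: n; exact: nearb.
  by rewrite fin_numE -ltNye -ltey (lt_le_trans _ lo) ?ltNyr// (le_lt_trans hi)// ltry.
apply/cvgrPdist_le => e e0; near=> n.
have : ((l - e)%:E <= scaled_lnP b P E n <= (l + e)%:E)%E by near: n; exact: nearb.
rewrite /comp; case: (scaled_lnP b P E n) => [r| |]; rewrite ?leNgt ?ltry ?ltNyr ?andbF//=.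
by rewrite -!leNgt !lee_fin ler_distlC; lra.
Unshelve. all: by end_near. Qed.

Lemma scaled_lnP_cvgNy :
  scaled_lnP b P E @ \oo --> -oo%E <->
  forall M : R, \forall n \near \oo, fine (P n (E n)) <= expR (M * n%:R `^ b).
Proof.
rewrite cvgeNyPle; split => h M; near=> n;
  have n0 : (0 < n)%N by near: n; exact: nbhs_infty_gt.
  by rewrite -scaled_lnP_le//; near: n; exact: h.
by rewrite scaled_lnP_le//; near: n; exact: h.
Unshelve. all: by end_near. Qed.

End ScaledLog.

(** * Negligible uniform tails, and a real constant from hypothesis (i) *)

Lemma uniform_ncycles_superexp (R : realType) (a b : R) (dsp : nat -> measure_display)
    (T : forall n, measurableType (dsp n)) (P : forall n, probability (T n) R)
    (X : forall n, {RV (P n) >-> 'S_n}) :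
  0 < b -> b <= a -> (forall n, (0 < n)%N -> uniform_rperm (X n)) ->
  forall eps M : R, 0 < eps -> \forall n \near \oo,
    fine (P n [set w | eps * n%:R `^ a < (ncycles (X n w))%:R]) <=
    expR (M * n%:R `^ b).
Proof.
move=> b0 ba uX eps M eps0.
(* With [eps * ln c >= 1 - M], the tail bound is at most
   [expR (c * ln n.+1 - (1 - M) * n^b)], and [c * ln n.+1 <= n^b] eventually. *)
pose c := (Num.truncn (expR ((1 - M) / eps))).+1.
have Mc : (1 - M) / eps <= ln (c%:R : R).
  rewrite -[leLHS]expRK ler_ln ?posrE ?expR_gt0 ?ltr0n//.
  by apply/ltW; rewrite truncnS_gt.
near=> n; have n0 : (0 < n)%N by near: n; exact: nbhs_infty_gt.
apply: (le_trans (@uniform_tail _ _ _ _ _ _ c _ (uX n n0) _)) => //.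
rewrite ler_expR.
have h1 : c%:R * ln n.+1%:R <= (n%:R : R) `^ b.
  by near: n; exact: near_ln_le_powR.
have h2 : (n%:R : R) `^ b <= n%:R `^ a by rewrite ler_powR// ler1n.
have v0 : (0 : R) <= n%:R `^ b by exact: powR_ge0.
have h3 : 1 - M <= ln c%:R * eps by rewrite -ler_pdivrMr.
have lc : 0 <= ln (c%:R : R) by rewrite ln_ge0// ler1n.
have h4 := ler_wpM2r v0 h3.
have h5 : ln c%:R * eps * n%:R `^ b <= ln c%:R * eps * n%:R `^ a.
  by rewrite ler_wpM2l// mulr_ge0// ltW.
lra.
Unshelve. all: by end_near. Qed.

Lemma Aset_bound (R : realType) (d : nat) (f : forall n : nat, 'S_n -> 'rV[R]_d) :
  (ereal_sup [set y : \bar R | exists (n : nat) (s : 'S_n), (0 < n)%N /\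
      y = ereal_sup [set (enorm (f n s - f n r) / (ncycles s)%:R)%:E
                    | r in [set` Aset s]]] < +oo)%E ->
  exists2 C : R, 0 < C & forall (n : nat) (s r : 'S_n), (0 < n)%N -> r \in Aset s ->
    enorm (f n s - f n r) <= C * (ncycles s)%:R.
Proof.
set S := ereal_sup _ => Sy.
(* The maximum with 1 makes the constant positive, so that it can be divided by. *)
exists (Num.max (fine S) 1); first by rewrite lt_max ltr01 orbT.
move=> n s r n0 rA; have c0 : (0 : R) < (ncycles s)%:R by rewrite ltr0n ncycles_gt0.
rewrite -ler_pdivrMr//.
have le1 : ((enorm (f n s - f n r) / (ncycles s)%:R)%:E <= S)%E.
  apply: (@le_trans _ _ (ereal_sup [set (enorm (f n s - f n r) / (ncycles s)%:R)%:E
      | r in [set` Aset s]])).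
    by apply: ereal_sup_ubound; exists r.
  by apply: ereal_sup_ubound; exists n, s.
case: S Sy le1 => [x| |]//= _; rewrite ?lee_fin// => h.
by rewrite (le_trans h)// le_max lexx.
Qed.

(** * Transfer of the limit from the uniform law to [sigma] *)

Theorem theorem1p6 (R : realType) (d : nat) (hd : (0 < d)%N)
  (f : forall n : nat, 'S_n -> 'rV[R]_d)
  (J : 'rV[R]_d -> R) (alpha beta : R) (I : set 'rV[R]_d)
  (dspU : nat -> measure_display) (TU : forall n, measurableType (dspU n))
  (PU : forall n, probability (TU n) R)
  (sigmaU : forall n, {RV (PU n) >-> 'S_n})
  (hU : forall n, (0 < n)%N -> uniform_rperm (sigmaU n))
  (dsp : nat -> measure_display) (T : forall n, measurableType (dsp n))
  (P : forall n, probability (T n) R)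
  (sigma : forall n, {RV (P n) >-> 'S_n})
  (hi : (ereal_sup [set y : \bar R | exists (n : nat) (s : 'S_n), (0 < n)%N /\
      y = ereal_sup [set (enorm (f n s - f n r) / (ncycles s)%:R)%:E
                    | r in [set` Aset s]]] < +oo)%E)
  (hJ : {within I, continuous J})
  (hbeta : 0 < beta) (hba : beta <= alpha) (halpha : alpha < 1)
  (hI : open I)
  (hii : forall x : 'rV[R]_d, I x ->
    scaled_lnP beta PU
      (fun n => [set w | vge (f n (sigmaU n w)) (n%:R `^ alpha *: x)]) @ \oo
    --> (- J x)%:E)
  (hiii : CI alpha beta sigma) :
  forall x : 'rV[R]_d, I x ->
    scaled_lnP beta P
      (fun n => [set w | vge (f n (sigma n w)) (n%:R `^ alpha *: x)]) @ \oo
    --> (- J x)%:E.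
Proof.
move=> x Ix; have [C C0 fC] := Aset_bound hi.
have [hc htail] := hiii.
pose ev n (y : 'rV[R]_d) := [set s : 'S_n | vge (f n s) (n%:R `^ alpha *: y)].
pose cvgU y := @scaled_lnP_cvg _ beta _ _ PU (fun n => sigmaU n @^-1` ev n y)
  (fun n => measurable_perm_event (sigmaU n) (ev n y)) (- J y).
apply/(@scaled_lnP_cvg _ beta _ _ P (fun n => sigma n @^-1` ev n x)
  (fun n => measurable_perm_event (sigma n) (ev n x)) (- J x)) => e e0.
have Jx : {for x, continuous J}.
  by move: hJ; rewrite continuous_open_subspace// => /(_ x); apply; rewrite inE.
have : nbhs x (fun y => I y /\ `|J x - J y| <= e / 4).
  apply: filterI; first exact: open_nbhs_nbhs.
  by move/cvgrPdist_le: Jx; apply; lra.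
move=> /nbhs_ballP[r /= r0 ballI].
pose delta := r / 2; have delta0 : 0 < delta by rewrite /delta; lra.
(* Adding a constant vector moves every coordinate by [t], as the order [vge] requires, and has sup
   norm at most [|t|], hence stays in the ball. *)
have inball t : `|t| <= delta -> I (x + const_mx t) /\ `|J x - J (x + const_mx t)| <= e / 4.
  move=> tr; apply: ballI; split=> // i j.
  rewrite !mxE /ball/= opprD addrA subrr sub0r normrN (le_lt_trans tr)//.
  by rewrite /delta; lra.
have [Ip Jp] := inball delta ltac:(by rewrite ger0_norm// ltW).
have [Im Jm] := inball (- delta) ltac:(by rewrite normrN ger0_norm// ltW).
have e4 : 0 < e / 4 by lra.
have Up := (cvgU _).1 (hii _ Ip) _ e4.
have Um := (cvgU _).1 (hii _ Im) _ e4.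
(* Chosen so that the shift [2 * C * k] of [compare_vge] at [k = eps * n^alpha] is exactly
   [delta * n^alpha]. *)
pose eps := delta / (2 * C); have eps0 : 0 < eps by rewrite divr_gt0// mulr_gt0.
have deltaE a : 2 * C * (eps * a) = delta * a by rewrite /eps; field; rewrite gt_eqF.
have tU := uniform_ncycles_superexp hbeta hba hU (- J x - e) eps0.
pose tailS n := [set s : 'S_n | (ncycles s)%:R / n%:R `^ alpha > eps].
have tS := (@scaled_lnP_cvgNy _ beta _ _ P (fun n => sigma n @^-1` tailS n)
  (fun n => measurable_perm_event (sigma n) (tailS n))).1 (htail _ eps0) (- J x - e).
near=> n; have n0 : (0 < n)%N by near: n; exact: nbhs_infty_gt.
have a0 : 0 < (n%:R : R) `^ alpha by rewrite powR_gt0// ltr0n.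
(* This makes [e / 2 * v] at least 2, whence [expR (e / 2 * v) >= 1 + 2]. *)
have v_ge : 4 / e <= (n%:R : R) `^ beta by near: n; exact: near_powR_ge.
have /andP[Up1 _] : expR ((- J (x + const_mx delta) - e / 4) * n%:R `^ beta) <=
    fine (PU n [set w | vge (f n (sigmaU n w)) (n%:R `^ alpha *: (x + const_mx delta))]) <=
    expR ((- J (x + const_mx delta) + e / 4) * n%:R `^ beta) by near: n; exact: Up.
have /andP[_ Um2] : expR ((- J (x + const_mx (- delta)) - e / 4) * n%:R `^ beta) <=
    fine (PU n [set w | vge (f n (sigmaU n w)) (n%:R `^ alpha *: (x + const_mx (- delta)))]) <=
    expR ((- J (x + const_mx (- delta)) + e / 4) * n%:R `^ beta) by near: n; exact: Um.
have tUn : fine (PU n [set w | eps * n%:R `^ alpha < (ncycles (sigmaU n w))%:R]) <=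
    expR ((- J x - e) * n%:R `^ beta) by near: n; exact: tU.
have tSn : fine (P n [set w | eps * n%:R `^ alpha < (ncycles (sigma n w))%:R]) <=
    expR ((- J x - e) * n%:R `^ beta).
  have -> : [set w | eps * n%:R `^ alpha < (ncycles (sigma n w))%:R] =
      sigma n @^-1` tailS n.
    by apply/seteqP; split => w; rewrite /tailS/= ltr_pdivlMr.
  by near: n; exact: tS.
have cS := conj_invariantP (hc n n0); have cU := conj_invariant_uniform (hU n n0).
have fCn s r' : r' \in Aset s -> enorm (f n s - f n r') <= C * (ncycles s)%:R.
  by exact: fC.
(* [sigma] at [x] is bounded by the uniform law at [x - delta]; in [lower], the uniform law at
   [x + delta] is bounded by [sigma] at [x]. *)
have upper := compare_vge n0 (ltW C0) fCn cS cU
  (y := n%:R `^ alpha *: x) (z := n%:R `^ alpha *: (x + const_mx (- delta)))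
  (k := eps * n%:R `^ alpha)
  ltac:(by move=> i; rewrite deltaE !mxE; lra).
have lower := compare_vge n0 (ltW C0) fCn cU cS
  (y := n%:R `^ alpha *: (x + const_mx delta)) (z := n%:R `^ alpha *: x)
  (k := eps * n%:R `^ alpha)
  ltac:(by move=> i; rewrite deltaE !mxE; lra).
set v := n%:R `^ beta in v_ge Up1 Um2 tUn tSn *.
have v0 : 0 <= v by exact: powR_ge0.
(* The factor [expR (e / 2 * v)] absorbs the sum of three probabilities. *)
have big3 : 3 <= expR (e / 2 * v).
  by rewrite (le_trans _ (expR_ge1Dx _))//; move: v_ge; rewrite ler_pdivrMr//; lra.
have split_exp l : expR ((l + e / 2) * v) = expR (e / 2 * v) * expR (l * v).
  by rewrite -expRD; congr expR; lra.
have mono l l' : l <= l' -> expR (l * v) <= expR (l' * v).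
  by move=> ll'; rewrite ler_expR ler_wpM2r.
have Up1' : expR ((- J x - e / 2) * v) <= expR ((- J (x + const_mx delta) - e / 4) * v).
  by apply: mono; move: Jp; rewrite ler_norml; lra.
have Um2' : expR ((- J (x + const_mx (- delta)) + e / 4) * v) <= expR ((- J x + e / 2) * v).
  by apply: mono; move: Jm; rewrite ler_norml; lra.
have small : expR ((- J x - e) * v) <= expR ((- J x + e / 2) * v) by apply: mono; lra.
have e1 := split_exp (- J x + e / 2); have e2 := split_exp (- J x - e).
have p1 := expR_gt0 ((- J x + e / 2) * v); have p2 := expR_gt0 ((- J x - e) * v).
have q1 := ler_wpM2r (ltW p1) big3; have q2 := ler_wpM2r (ltW p2) big3.
rewrite (_ : - J x + e / 2 + e / 2 = - J x + e) in e1; last lra.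
rewrite (_ : - J x - e + e / 2 = - J x - e / 2) in e2; last lra.
(* Below, two tails are subtracted from [expR ((- J x - e / 2) * v)], which is at least three times
   [expR ((- J x - e) * v)]. Above, all three terms are at most [expR ((- J x + e / 2) * v)]. *)
apply/andP; split; lra.
Unshelve. all: by end_near. Qed.
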